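(* Let $a,b$ be positive integers with $1\le a\le b$. Every nonnegative integer can be written as $ax^2+by^2+2(z^2+zw+w^2)$ with $x,y,z,w\in\mathbb{Z}$ if and only if $a=1$ and $b\in\{1,2,3,4,5\}$. *)

(* Defs.v *)
From Stdlib Require Import ZArith.
Open Scope Z_scope.

Definition form (a b x y z w : Z) : Z :=
  a * x ^ 2 + b * y ^ 2 + 2 * (z ^ 2 + z * w + w ^ 2).

Definition universal (a b : Z) : Prop :=
  forall n : Z, 0 <= n -> exists x y z w : Z, form a b x y z w = n.

(* Main.v *)
Require Import Defs.
From Stdlib Require Import ZArith Lia.
Open Scope Z_scope.

(* The form x^2 + 2(z^2 + zw + w^2) represents n as soon as 3n is a sum of three squares,
   so everything reduces to the three-square theorem, applied to 3(n - b y^2) with a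
   suitable y in {0, 1, 2} after removing factors 4.

   The three-square theorem is proved without Dirichlet's theorem on primes.  An integer m is
   a sum of three squares once there is t > 0 with -m a square modulo t and -t the inverse of
   a square modulo m: these data give a positive ternary form of determinant 1 representing m,
   and Hermite reduction makes it a sum of three squares.  To find t, let chi be the quadratic
   character (-m / .) modulo M, made periodic by quadratic reciprocity, and a a class with
   chi(a) = 1.  A hyperbola-method estimate shows that the sum over d | q of chi(d) is
   nonzero for some q congruent to a modulo M; such a q is a square times a product of
   primes modulo which -m is a square. *)

(** * Reduction of integral quadratic forms *)

Lemma center_residue (a b : Z) : 0 < a -> exists k, 2 * Z.abs (b + k * a) <= a.
Proof.
intros ha.
pose proof (Z.div_mod b a ltac:(lia)) as E.
pose proof (Z.mod_pos_bound b a ha) as B.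
destruct (Z_le_gt_dec (2 * (b mod a)) a) as [h | h].
- exists (- (b / a)). nia.
- exists (- (b / a) - 1). nia.
Qed.

(** Gauss reduction by descent on [A]: centre [B] so that [2 * |B| <= A], then swap the outer
    coefficients if [C < A]. Once [A <= C], the bound follows from [A * A <= A * C = D + B * B] and
    [4 * B * B <= A * A]. *)
Lemma binary_reduction (n : nat) (D A B C : Z) :
  (Z.to_nat A <= n)%nat -> 0 < D -> 0 < A -> A * C - B * B = D ->
  exists p q r s, p * s - q * r = 1 /\
    3 * (A * p * p + 2 * B * p * r + C * r * r) ^ 2 <= 4 * D.
Proof.
revert A B C; induction n as [|n IH]; intros A B C hn hD hA E; [lia|].
destruct (center_residue A B hA) as [k hk].
set (B' := B + k * A) in *.
set (C' := C + 2 * k * B + k * k * A).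
assert (E' : A * C' - B' * B' = D) by (unfold B', C'; nia).
destruct (Z_lt_le_dec C' A) as [h | h].
- assert (hC : 0 < C') by nia.
  destruct (IH C' (- B') A) as (p & q & r & s & hu & hr); try lia.
  exists (k * p - r), (k * q - s), p, q. split; [nia|].
  replace (A * (k * p - r) * (k * p - r) + 2 * B * (k * p - r) * p + C * p * p)
    with (C' * p * p + 2 * - B' * p * r + A * r * r)
    by (unfold B', C'; ring).
  exact hr.
- exists 1, 0, 0, 1. split; [lia|]. 
  assert (4 * (B' * B') <= A * A) by nia. nia.
Qed.

Definition tern (a b c d e h x y z : Z) : Z :=
  a * x * x + b * y * y + c * z * z + 2 * d * y * z + 2 * e * x * z + 2 * h * x * y.

Definition tern_det (a b c d e h : Z) : Z :=
  a * b * c + 2 * d * e * h - a * d * d - b * e * e - c * h * h.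

(** Completing the square shows this to be [A] times the value at [(p, r)] of a form of determinant
    [a]; the vector is nonzero since it extends to a unimodular matrix. *)
Lemma binary_positive (a A B p q r s : Z) :
  0 < a -> 0 < A -> p * s - q * r = 1 -> 0 < (A * p + B * r) ^ 2 + a * (r * r).
Proof.
intros ha hA hu. destruct (Z.eq_dec r 0) as [r0 | r0].
- subst r. assert (p <> 0) by lia. assert (A * p <> 0) by nia. nia.
- assert (0 < r * r) by nia. nia.
Qed.

Lemma binary_unimodular (A B C y z : Z) : 0 < A -> A * C - B * B = 1 ->
  exists v w, A * y * y + 2 * B * y * z + C * z * z = v * v + w * w.
Proof.
intros hA E.
destruct (binary_reduction (Z.to_nat A) 1 A B C) as (p & q & r & s & hu & hr); try lia.
set (A' := A * p * p + 2 * B * p * r + C * r * r) in *.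
set (B' := A * p * q + B * (p * s + q * r) + C * r * s).
set (C' := A * q * q + 2 * B * q * s + C * s * s).
assert (hp : A * A' = (A * p + B * r) ^ 2 + 1 * (r * r)).
{ rewrite <- E. unfold A'; ring. }
assert (hA1 : A' = 1).
{ pose proof (binary_positive 1 A B p q r s ltac:(lia) hA hu) as H. rewrite <- hp in H.
  assert (0 < A') by (apply (Z.mul_pos_cancel_l A); assumption). nia. }
assert (E' : A' * C' - B' * B' = 1).
{ replace 1 with ((A * C - B * B) * (p * s - q * r) ^ 2) by (rewrite E, hu; ring).
  unfold A', B', C'; ring. }
rewrite hA1 in E'.
(* Coordinates of [(y, z)] in the reduced basis. As [A' = 1], completing the square leaves
   [W * W]. *)
set (Y := s * y - q * z). set (W := p * z - r * y).
exists (Y + B' * W), W.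
replace (A * y * y + 2 * B * y * z + C * z * z)
  with ((A * y * y + 2 * B * y * z + C * z * z) * (p * s - q * r) ^ 2)
  by (rewrite hu; ring).
transitivity (A' * Y * Y + 2 * B' * Y * W + C' * W * W);
  [unfold A', B', C', Y, W; ring |].
replace C' with (1 + B' * B') by lia. rewrite hA1. ring.
Qed.

(* Hermite's descent on the first coefficient [a]: completing the square leaves
   a binary form of determinant [a], and reducing it brings the second diagonal
   coefficient below [a] as long as [a >= 2]. *)
Lemma ternary_unimodular (n : nat) (a b c d e h x y z : Z) :
  (Z.to_nat a <= n)%nat ->
  0 < a -> 0 < a * b - h * h -> tern_det a b c d e h = 1 ->
  exists u v w, tern a b c d e h x y z = u * u + v * v + w * w.
Proof.
revert a b c d e h x y z; induction n as [|n IH];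
  intros a b c d e h x y z hn ha hA hdet; [lia|].
set (A := a * b - h * h) in *.
set (B := a * d - h * e).
set (C := a * c - e * e).
assert (E : A * C - B * B = a).
{ replace a with (a * tern_det a b c d e h) at 1 by (rewrite hdet; ring).
  unfold A, B, C, tern_det; ring. }
destruct (Z.eq_dec a 1) as [a1 | a1].
{ rewrite a1 in E.
  destruct (binary_unimodular A B C y z hA E) as (v & w & hvw).
  exists (x + h * y + e * z), v, w.
  rewrite <- Z.add_assoc, <- hvw. unfold tern, A, B, C. rewrite a1; ring. }
destruct (binary_reduction (Z.to_nat A) a A B C) as (p & q & r & s & hu & hr); try lia.
destruct (center_residue a (h * p + e * r) ha) as [k hk].
set (A' := A * p * p + 2 * B * p * r + C * r * r) in *.
(* Gram coefficients in the basis [(k, p, r)], [(1, 0, 0)], [(0, q, s)]. The vector of smaller value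
   [b'] is put first for the descent. *)
set (b' := tern a b c d e h k p r).
set (c' := tern a b c d e h 0 q s).
set (h' := h * p + e * r + k * a) in *.
set (e' := h * q + e * s).
set (d' := b * p * q + c * r * s + d * (p * s + q * r) + k * e').
assert (hp : A * A' = (A * p + B * r) ^ 2 + a * (r * r)).
{ rewrite <- E at 1. unfold A'; ring. }
assert (hA' : 0 < A').
{ pose proof (binary_positive a A B p q r s ha hA hu) as H. rewrite <- hp in H.
  apply (Z.mul_pos_cancel_l A); assumption. }
assert (EA : a * b' - h' * h' = A') by (unfold b', h', A', A, B, C, tern; ring).
assert (hb0 : 0 < b').
{ apply (Z.mul_pos_cancel_l a); [assumption|].
  pose proof (Z.square_nonneg h'). lia. }
(* If [a <= b'], then [a * a <= a * b' = A' + h' * h'], where [A' < a] and [4 * h' * h' <= a * a]: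
   impossible for [a >= 2]. *)
assert (hb : b' < a).
{ assert (h4 : 4 * (h' * h') <= a * a).
  { rewrite <- (Z.abs_square h'). pose proof (Z.abs_nonneg h').
    assert (2 * Z.abs h' * (2 * Z.abs h') <= a * a) by (apply Z.mul_le_mono_nonneg; lia).
    lia. }
  assert (a2 : 2 * a <= a * a) by (apply Z.mul_le_mono_nonneg_r; lia).
  assert (hAa : A' < a).
  { destruct (Z_lt_le_dec A' a) as [|h0]; [assumption|].
    assert (a * a <= A' * A') by (apply Z.mul_le_mono_nonneg; lia).
    rewrite Z.pow_2_r in hr. lia. }
  destruct (Z_lt_le_dec b' a) as [|hba]; [assumption|].
  assert (a * a <= a * b') by (apply Z.mul_le_mono_nonneg_l; lia).
  lia. }
assert (hdet' : tern_det b' a c' e' d' h' = 1).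
{ rewrite <- hdet.
  replace (tern_det a b c d e h) with (tern_det a b c d e h * (p * s - q * r) ^ 2)
    by (rewrite hu; ring).
  unfold tern_det, b', c', d', e', h', tern; ring. }
set (Y := s * y - q * z). set (W := p * z - r * y).
destruct (IH b' a c' e' d' h' Y (x - k * Y) W) as (u & v & w & huvw); try lia.
exists u, v, w. rewrite <- huvw.
replace y with (p * Y + q * W) by (transitivity ((p * s - q * r) * y);
  [unfold Y, W; ring | rewrite hu; ring]).
replace z with (r * Y + s * W) by (transitivity ((p * s - q * r) * z);
  [unfold Y, W; ring | rewrite hu; ring]).
generalize Y W; intros Y0 W0.
unfold tern, b', c', d', e', h', tern. ring.
Qed.

(* The ternary form below has determinant 1 and takes the value [m] at (0,0,1). *)
Lemma three_squares_of_congruences (m t t' s r e : Z) : 0 < m -> 0 < t ->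
  t * t' = s * s + m -> r * r * t + 1 = m * e ->
  exists x y z, m = x * x + y * y + z * z.
Proof.
intros hm ht E1 E2.
assert (he : 0 < e) by nia.
assert (hdet : tern_det (t * e) (t' * e - r * r) m (r * s) (r * t) (s * e) = 1).
{ transitivity ((m * e - r * r * t) ^ 2
      + (e * e * m - t * e * r * r) * (t * t' - s * s - m));
    [unfold tern_det; ring | rewrite E1, <- E2; ring]. }
(* Positivity: the leading minor of size 2 is [e * (m * e - r * r * t) = e]. *)
destruct (ternary_unimodular (Z.to_nat (t * e)) (t * e) (t' * e - r * r) m
  (r * s) (r * t) (s * e) 0 0 1) as (u & v & w & huvw); try nia.
exists u, v, w. rewrite <- huvw. unfold tern. ring.
Qed.
(** * Universality from sums of three squares *)

(** Changing the sign of [a] trades residue 2 for 1. With residues 0 and 1 only, three squares sum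
    to a multiple of 3 exactly when the residues agree. *)
Lemma sign_mod3 (a : Z) : exists u r, (r = 0 \/ r = 1) /\ (3 * u + r) * (3 * u + r) = a * a.
Proof.
pose proof (Z.div_mod a 3 ltac:(lia)) as E.
pose proof (Z.mod_pos_bound a 3 ltac:(lia)) as B.
assert (a mod 3 = 0 \/ a mod 3 = 1 \/ a mod 3 = 2) as [h | [h | h]] by lia; rewrite h in E.
- exists (a / 3), 0. split; [tauto | rewrite E at 3 4; ring].
- exists (a / 3), 1. split; [tauto | rewrite E at 3 4; ring].
- exists (- (a / 3) - 1), 1. split; [tauto | rewrite E at 3 4; ring].
Qed.

(* The cubic lattice contains, with index 3, the orthogonal sum of the diagonal
   line and of the plane of vectors with coordinate sum 0. *)
Lemma represents_of_three_squares (n a b c : Z) : 3 * n = a * a + b * b + c * c ->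
  exists x z w, n = x ^ 2 + 2 * (z ^ 2 + z * w + w ^ 2).
Proof.
intros E.
destruct (sign_mod3 a) as (u & r & hr & hu).
destruct (sign_mod3 b) as (v & s & hs & hv).
destruct (sign_mod3 c) as (k & t & ht & hk).
rewrite <- hu, <- hv, <- hk in E. clear hu hv hk.
assert (r = s /\ s = t) as [<- <-]
  by (destruct hr as [-> | ->]; destruct hs as [-> | ->]; destruct ht as [-> | ->]; lia).
(* One third of the coordinate sum, and thirds of two differences of coordinates. *)
exists (u + v + k + r), (u - v), (v - k). lia.
Qed.

Local Ltac mod_lia := Z.to_euclidean_division_equations; lia.

Lemma universal_one (b : Z) :
  (forall m, 0 <= m -> m mod 8 = 1 \/ m mod 8 = 2 \/ m mod 8 = 3 \/ m mod 8 = 5 \/ m mod 8 = 6 ->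
    exists x y z, m = x * x + y * y + z * z) ->
  b = 1 \/ b = 2 \/ b = 3 \/ b = 4 \/ b = 5 -> universal 1 b.
Proof.
intros H3 hb n.
(* Multiplication by 3 sends the classes 1, 2, 3, 6, 7 modulo 8 to 3, 6, 1, 2, 5. *)
assert (T : forall m, 0 <= m -> m mod 4 <> 0 -> m mod 8 <> 5 ->
    exists x z w, m = x ^ 2 + 2 * (z ^ 2 + z * w + w ^ 2)).
{ intros m h0 h4 h8. destruct (H3 (3 * m)) as (x & y & z & h); [lia | clear - h4 h8; mod_lia |].
  exact (represents_of_three_squares _ _ _ _ h). }
assert (Ty : forall m y, 0 <= m - b * y ^ 2 -> (m - b * y ^ 2) mod 4 <> 0 ->
    (m - b * y ^ 2) mod 8 <> 5 -> exists x y z w, form 1 b x y z w = m).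
{ intros m y h0 h4 h8. destruct (T _ h0 h4 h8) as (x & z & w & h).
  exists x, y, z, w. unfold form. lia. }
intros hn. revert n hn. apply (Zlt_0_ind (fun n => exists x y z w, form 1 b x y z w = n)).
intros n IH hn.
destruct (Z.eq_dec n 0) as [-> | n0]; [exists 0, 0, 0, 0; unfold form; ring|].
destruct (Z.eq_dec (n mod 4) 0) as [h4 | h4].
{ assert (E := Z_div_exact_full_2 n 4 ltac:(discriminate) h4).
  destruct (IH (n / 4)) as (x & y & z & w & h).
  { clear - hn n0 E. generalize dependent (n / 4). intros. lia. }
  exists (2 * x), (2 * y), (2 * z), (2 * w).
  rewrite E, <- h. unfold form; ring. }
clear IH T.
destruct (Z.eq_dec (n mod 8) 5) as [h8 | h8]; [|apply (Ty n 0); mod_lia].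
(* For [b = 1] and [b = 5], taking [y = 1] would leave a multiple of 4, hence [y = 2]. With [b = 5]
   this needs [n >= 20], so 5 and 13 are treated by hand. *)
destruct hb as [-> | [-> | [-> | [-> | ->]]]].
- apply (Ty n 2); mod_lia.
- apply (Ty n 1); mod_lia.
- apply (Ty n 1); mod_lia.
- apply (Ty n 1); mod_lia.
- destruct (Z.eq_dec n 5) as [-> | n5]; [exists 0, 1, 0, 0; reflexivity|].
  destruct (Z.eq_dec n 13) as [-> | n13]; [exists 0, 1, 2, 0; reflexivity|].
  apply (Ty n 2); mod_lia.
Qed.

(** The value 1 forces [a = 1]. The value 5 is missed by [x^2 + 2(z^2 + zw + w^2)], so it needs
    [y <> 0], which contributes at least [b]. *)
Lemma universal_necessary (a b : Z) : 1 <= a -> a <= b -> universal a b -> a = 1 /\ b <= 5.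
Proof.
intros ha hab U.
assert (Q : forall z w, 0 <= z ^ 2 + z * w + w ^ 2).
{ intros z w. pose proof (Z.square_nonneg (2 * z + w)). pose proof (Z.square_nonneg w). lia. }
assert (S : forall c x, 1 <= c -> x <> 0 -> c <= c * x ^ 2).
{ intros c x hc hx. rewrite Z.pow_2_r. assert (0 < x * x) by nia. nia. }
assert (P : forall c x, 1 <= c -> 0 <= c * x ^ 2).
{ intros c x hc. rewrite Z.pow_2_r. pose proof (Z.square_nonneg x). nia. }
assert (a1 : a = 1).
{ destruct (U 1 ltac:(lia)) as (x & y & z & w & h). unfold form in h.
  specialize (Q z w). pose proof (P a x ha). pose proof (P b y ltac:(lia)).
  destruct (Z.eq_dec x 0) as [-> | x0]; [|pose proof (S a x ha x0); lia].
  destruct (Z.eq_dec y 0) as [-> | y0]; [lia|].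
  pose proof (S b y ltac:(lia) y0); lia. }
split; [exact a1|]. subst a.
destruct (Z_le_gt_dec b 5) as [h | hb]; [exact h | exfalso].
destruct (U 5 ltac:(lia)) as (x & y & z & w & h). unfold form in h.
specialize (Q z w). pose proof (P 1 x ha).
destruct (Z.eq_dec y 0) as [-> | y0]; [|pose proof (S b y ltac:(lia) y0); lia].
clear S P U.
assert (-2 <= x <= 2) by nia.
assert (h2 : z ^ 2 + z * w + w ^ 2 <= 2) by lia.
assert (-2 <= w <= 2) by nia. assert (-2 <= z <= 2) by nia.
assert (X : x = -2 \/ x = -1 \/ x = 0 \/ x = 1 \/ x = 2) by lia.
assert (W : w = -2 \/ w = -1 \/ w = 0 \/ w = 1 \/ w = 2) by lia.
assert (V : z = -2 \/ z = -1 \/ z = 0 \/ z = 1 \/ z = 2) by lia.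
repeat match goal with H : _ \/ _ |- _ => destruct H as [-> | H] end;
  subst; lia.
Qed.

From mathcomp Require Import all_boot all_order all_algebra.
From mathcomp Require Import all_fingroup all_solvable all_field realalg.
From mathcomp Require Import ring lra zify.
Set Implicit Arguments.
Unset Strict Implicit.
Unset Printing Implicit Defensive.
Import Order.TTheory GRing.Theory Num.Theory.
Local Open Scope nat_scope.
Local Open Scope ring_scope.

(** * The hyperbola method *)

Section PeriodicSums.
Variable R : rcfType.
Implicit Types (h w : nat -> R) (K : nat -> nat -> R).

Lemma periodic_modn (T : Type) (h : nat -> T) M :
  (forall n, h (n + M)%N = h n) -> forall n, h (n %% M)%N = h n.
Proof.
move=> hM n; rewrite [in RHS](divn_eq n M) addnC.
by elim: (n %/ M)%N => [|k IH]; rewrite ?addn0 // mulSnr addnA hM.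
Qed.

(** The partial sums from 0 are themselves periodic, hence at most [M * B]; a general range is a
    difference of two of them. *)
Lemma periodic_sum_bound h M B : (0 < M)%N ->
  (forall n, h (n + M)%N = h n) -> \sum_(0 <= i < M) h i = 0 ->
  (forall n, `|h n| <= B) ->
  forall a b, (a <= b)%N -> `|\sum_(a <= i < b) h i| <= 2 * M%:R * B.
Proof.
move=> M0 hM h0 hB a b ab.
pose S n := \sum_(0 <= i < n) h i.
have SM n : S (n + M)%N = S n.
  elim: n => [|n IH]; first by rewrite add0n /S h0 big_geq.
  by rewrite addSn /S !big_nat_recr //= -!/(S _) IH hM.
have SB n : `|S n| <= M%:R * B.
  rewrite -(periodic_modn SM) /S; apply: le_trans (ler_norm_sum _ _ _) _.
  apply: le_trans (ler_sum _ (fun i _ => hB i)) _.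
  rewrite sumr_const_nat subn0 -[leLHS]mulr_natl ler_wpM2r ?ler_nat ?(ltnW (ltn_pmod _ _)) //.
  exact: le_trans (hB 0%N).
have -> : \sum_(a <= i < b) h i = S b - S a.
  by rewrite [S b](@big_cat_nat _ _ _ a) //= addrAC -/(S a) subrr add0r.
apply: le_trans (ler_normB _ _) _.
have := SB a; have := SB b; lra.
Qed.

Lemma abel_bound h w B a b : (a <= b)%N ->
  (forall n, (a <= n)%N -> w n.+1 <= w n) -> (forall n, 0 <= w n) ->
  (forall c, (a <= c)%N -> `|\sum_(a <= i < c) h i| <= B) ->
  `|\sum_(a <= i < b) h i * w i| <= B * w a.
Proof.
move=> ab wd w0 hB; pose S n := \sum_(a <= i < n) h i.
(* Summation by parts: with the boundary term removed, the bound telescopes and the induction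
   closes. *)
suff H : `|\sum_(a <= i < b) h i * w i - S b * w b| <= B * (w a - w b).
  have : `|S b * w b| <= B * w b by rewrite normrM (ger0_norm (w0 b)) ler_wpM2r ?hB.
  have := ler_normD (\sum_(a <= i < b) h i * w i - S b * w b) (S b * w b).
  rewrite subrK; lra.
elim: b ab => [|b IH].
  rewrite leqn0 => /eqP ->; rewrite /S !big_geq // mul0r subrr normr0.
  by rewrite subrr mulr0.
rewrite leq_eqVlt => /orP[/eqP <-|]; first by rewrite /S !big_geq // mul0r !subrr normr0 mulr0.
rewrite ltnS => ab; rewrite big_nat_recr //=.
have -> : \sum_(a <= i < b) h i * w i + h b * w b - S b.+1 * w b.+1 =
   (\sum_(a <= i < b) h i * w i - S b * w b) + S b.+1 * (w b - w b.+1).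
  by rewrite /S [\sum_(a <= i < b.+1) h i]big_nat_recr //=; ring.
apply: le_trans (ler_normD _ _) _.
have := IH ab.
have : `|S b.+1 * (w b - w b.+1)| <= B * (w b - w b.+1).
  by rewrite normrM (ger0_norm (_ : 0 <= w b - _)) ?subr_ge0 ?wd // ler_wpM2r ?subr_ge0 ?wd // hB // ltnW.
lra.
Qed.

(** The exponent 1/2 balances the error terms of the hyperbola method, while squares get the weights
    [1/k] of the harmonic series. The value at 0 is 0. *)
Definition isqrt (n : nat) : R := (Num.sqrt n%:R)^-1.

Lemma isqrt_ge0 n : 0 <= isqrt n.
Proof. by rewrite invr_ge0 sqrtr_ge0. Qed.

Lemma isqrt1 : isqrt 1 = 1.
Proof. by rewrite /isqrt sqrtr1 invr1. Qed.

Lemma isqrt_le m n : (0 < m)%N -> (m <= n)%N -> isqrt n <= isqrt m.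
Proof.
move=> m0 mn; rewrite lef_pV2 ?posrE ?sqrtr_gt0 ?ltr0n ?(leq_trans m0) //.
by rewrite ler_wsqrtr // ler_nat.
Qed.

Lemma isqrtM m n : isqrt (m * n) = isqrt m * isqrt n.
Proof. by rewrite /isqrt natrM sqrtrM ?ler0n // invfM. Qed.

Lemma isqrt_sqr n : isqrt (n * n) = n%:R^-1.
Proof. by rewrite /isqrt natrM -expr2 sqrtr_sqr ger0_norm. Qed.

Lemma sum_isqrt_le N : \sum_(1 <= d < N.+1) isqrt d <= 2 * Num.sqrt N%:R.
Proof.
elim: N => [|N IH]; first by rewrite big_geq // sqrtr0 mulr0.
rewrite big_nat_recr //=; apply: le_trans (lerD IH (lexx _)) _.
rewrite /isqrt; set x := Num.sqrt N%:R; set y := Num.sqrt N.+1%:R.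
have y0 : 0 < y by rewrite sqrtr_gt0 ltr0n.
have x0 : 0 <= x by rewrite sqrtr_ge0.
have E : y ^+ 2 = x ^+ 2 + 1 by rewrite !sqr_sqrtr ?ler0n // -natr1.
rewrite -(ler_pM2r y0) mulrDl mulVf ?gt_eqF //.
(* The goal [2xy + 1 <= 2y^2] is [(y - x)^2 >= 0] in view of [E]. *)
nra.
Qed.

(* Dirichlet's hyperbola method: the pairs with [d <= N] are summed over [e]
   first, the remaining ones over [d] first. *)
Lemma hyperbola_bound K M B0 : (0 < M)%N ->
  (forall d e, K (d + M)%N e = K d e) -> (forall d e, K d (e + M)%N = K d e) ->
  (forall e, \sum_(0 <= d < M) K d e = 0) -> (forall d, \sum_(0 <= e < M) K d e = 0) ->
  (forall d e, `|K d e| <= B0) ->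
  exists C, forall N, (0 < N)%N ->
    `|\sum_(1 <= d < (N * N).+1) \sum_(1 <= e < (N * N).+1 | (d * e <= N * N)%N)
        K d e * (isqrt d * isqrt e)| <= C.
Proof.
move=> M0 Kd Ke K1 K2 KB.
pose B := 2 * M%:R * B0.
have B0_ge0 : 0 <= B0 by exact: le_trans (KB 0%N 0%N).
have B_ge0 : 0 <= B by rewrite !mulr_ge0.
have sd a n : (0 < a)%N -> (a <= n)%N -> isqrt n.+1 <= isqrt n.
  by move=> a0 an; apply: isqrt_le; rewrite ?(leq_trans a0).
have col d a b : (0 < a)%N -> (a <= b)%N ->
    `|\sum_(a <= e < b) K d e * isqrt e| <= B * isqrt a.
  move=> a0 ab; apply: abel_bound => // [n|n|c]; [exact: sd | exact: isqrt_ge0 |].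
  exact: periodic_sum_bound.
have row e a b : (0 < a)%N -> (a <= b)%N ->
    `|\sum_(a <= d < b) K d e * isqrt d| <= B * isqrt a.
  move=> a0 ab; apply: (@abel_bound (K^~ e)) => // [n|n|c]; [exact: sd | exact: isqrt_ge0 |].
  exact: (@periodic_sum_bound (K^~ e)).
(* The terms bound, in order, the full columns [d <= N], their tails beyond the hyperbola, and the
   region [d > N]. *)
exists (2 * M%:R * B + B + 2 * B) => N N0.
set X := (N * N)%N.
have NX : (N <= X)%N by rewrite leq_pmulr.
rewrite (big_cat_nat (n := N.+1)) //=.
apply: le_trans (ler_normD _ _) _; apply: lerD.
- have E d : (1 <= d < N.+1)%N ->
      \sum_(1 <= e < X.+1 | (d * e <= X)%N) K d e * (isqrt d * isqrt e) =
      (\sum_(1 <= e < X.+1) K d e * isqrt e) * isqrt d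
       - (\sum_((X %/ d).+1 <= e < X.+1) K d e * isqrt e) * isqrt d.
    move=> /andP[d0 dN].
    have dX : ((X %/ d).+1 <= X.+1)%N by rewrite ltnS leq_div.
    rewrite -mulrBl [X in _ = (X - _) * _](@big_cat_nat _ _ _ (X %/ d).+1) //= addrK.
    rewrite (big_nat_widen _ _ _ _ _ dX) /= mulr_suml; apply: eq_big => e; last by move=> _; ring.
    by rewrite ltnS leq_divRL // mulnC.
  rewrite (eq_big_nat _ _ E) sumrB.
  apply: le_trans (ler_normB _ _) _; apply: lerD.
    (* The column sums are again periodic in [d] with zero sum over a period, and bounded by [B], so
       the same two estimates apply to them. *)
    pose Th d := \sum_(1 <= e < X.+1) K d e * isqrt e.
    have -> : 2 * M%:R * B = 2 * M%:R * B * isqrt 1 by rewrite isqrt1 mulr1.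
    apply: (@abel_bound Th) => // [n|n|c c0]; [exact: sd | exact: isqrt_ge0 |].
    apply: periodic_sum_bound => // [n||d].
    + by apply: eq_bigr => e _; rewrite Kd.
    + by rewrite exchange_big big1 //= => e _; rewrite -mulr_suml K1 mul0r.
    + by have := col d 1%N X.+1; rewrite isqrt1 mulr1; apply.
  apply: le_trans (ler_norm_sum _ _ _) _.
  (* Each tail costs at most [B / N], because [d * (X %/ d).+1 >= N * N]. *)
  have -> : B = \sum_(1 <= d < N.+1) B / N%:R.
    by rewrite sumr_const_nat subn1 /= -[RHS]mulr_natr divfK // pnatr_eq0 -lt0n.
  apply: ler_sum_nat => d /andP[d0 dN].
  rewrite normrM (ger0_norm (isqrt_ge0 d)).
  have dX : ((X %/ d).+1 <= X.+1)%N by rewrite ltnS leq_div.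
  apply: le_trans (ler_wpM2r (isqrt_ge0 d) (col d _ _ _ dX)) _ => //.
  rewrite -mulrA ler_wpM2l // -isqrtM -isqrt_sqr isqrt_le ?muln_gt0 ?N0 //.
  by rewrite -/X ltnW // -ltn_divLR.
- have -> : \sum_(N.+1 <= d < X.+1) \sum_(1 <= e < X.+1 | (d * e <= X)%N)
        K d e * (isqrt d * isqrt e) =
      \sum_(1 <= e < X.+1) (\sum_(N.+1 <= d < X.+1 | (d * e <= X)%N) K d e * isqrt d) * isqrt e.
    rewrite (exchange_big_dep_nat xpredT) //=; apply: eq_bigr => e _.
    by rewrite mulr_suml; apply: eq_bigr => d _; ring.
  (* Since [d > N] here, only [e <= N] can satisfy [d * e <= N * N]. *)
  rewrite (big_cat_nat (n := N.+1)) //= [X in _ + X]big_nat_cond [X in _ + X]big1 ?addr0; last first.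
    move=> e /andP[/andP[Ne _] _]; rewrite big_nat_cond big_pred0 ?mul0r // => d.
    apply/negP => /andP[/andP[Nd _]].
    by apply/negP; rewrite -ltnNge /X; apply: ltn_mul.
  have -> : 2 * B = B * (2 : R) by ring.
  apply: le_trans (ler_norm_sum _ _ _) _.
  apply: (@le_trans _ _ (\sum_(1 <= e < N.+1) (B * isqrt N.+1) * isqrt e)).
    apply: ler_sum_nat => e /andP[e0 eN]; rewrite normrM (ger0_norm (isqrt_ge0 e)).
    rewrite ler_wpM2r ?isqrt_ge0 //.
    have eX : ((X %/ e).+1 <= X.+1)%N by rewrite ltnS leq_div.
    have Ne : (N <= X %/ e)%N by rewrite leq_divRL // leq_mul2l -ltnS eN orbT.
    have := row e N.+1 (X %/ e).+1 isT Ne.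
    rewrite (big_nat_widen _ _ _ _ _ eX) /=.
    by rewrite (eq_bigl (fun d => (d * e <= X)%N)) // => d; rewrite ltnS leq_divRL.
  rewrite -mulr_sumr -mulrA ler_wpM2l //.
  apply: le_trans (ler_wpM2l (isqrt_ge0 _) (sum_isqrt_le N)) _.
  have y0 : 0 < Num.sqrt N.+1%:R :> R by rewrite sqrtr_gt0 ltr0n.
  rewrite /isqrt mulrC ler_pdivrMr // ler_pM2l // ler_wsqrtr // ler_nat //.
Qed.

End PeriodicSums.

(** * Divisor sums of quadratic characters *)

Record real_char (M : nat) (chi : nat -> int) : Prop := RealChar {
  real_char1 : chi 1%N = 1;
  real_charM : forall m n, chi (m * n)%N = chi m * chi n;
  real_charD : forall n, chi (n + M)%N = chi n;
  real_char_cop : forall n, coprime n M -> chi n = 1 \/ chi n = -1;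
  real_char_ncop : forall n, ~~ coprime n M -> chi n = 0 }.

Lemma prime_power_ind (P : nat -> Prop) : P 1%N ->
  (forall p v u, prime p -> ~~ (p %| u)%N -> (0 < u)%N -> P u -> P (p ^ v.+1 * u)%N) ->
  forall n, (0 < n)%N -> P n.
Proof.
move=> P1 PM n; elim/ltn_ind: n => n IH n0.
have [->//|n1] := eqVneq n 1%N.
have n2 : (1 < n)%N by rewrite ltn_neqAle eq_sym n1.
have pp := pdiv_prime n2.
have [u pu En] := pfactor_coprime pp n0.
have v0 : (0 < logn (pdiv n) n)%N by rewrite logn_gt0 mem_primes pp n0 pdiv_dvd.
have u0 : (0 < u)%N by move: n0; rewrite {1}En muln_gt0 => /andP[].
rewrite En mulnC -(prednK v0); apply: PM => //; first by rewrite -prime_coprime.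
apply: IH => //; rewrite [ltnRHS]En -[ltnLHS]muln1 ltn_pmul2l //.
by rewrite -(prednK v0) expnS (leq_trans (prime_gt1 pp)) // leq_pmulr // expn_gt0 prime_gt0.
Qed.

Section DivisorSum.
Variables (M : nat) (chi : nat -> int).
Hypothesis hchi : real_char M chi.

(** The coefficients of the Dirichlet series zeta(s) L(s, chi). *)
Definition divisor_sum (n : nat) : int := \sum_(d <- divisors n) chi d.

Lemma real_char_cases n : [\/ chi n = 0, chi n = 1 | chi n = -1].
Proof.
have [/(real_char_cop hchi)[]|/(real_char_ncop hchi)] := boolP (coprime n M);
  by [constructor 2 | constructor 3 | constructor 1].
Qed.

Lemma divisor_sum1 : divisor_sum 1 = 1.
Proof. by rewrite /divisor_sum big_seq1 (real_char1 hchi). Qed.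

(** Divisors that are multiples of [p] are [p] times a divisor of [p ^ v * u]; the others divide
    [u]. *)
Lemma divisor_sumSp p v u : prime p -> ~~ (p %| u)%N -> (0 < u)%N ->
  divisor_sum (p ^ v.+1 * u) = chi p * divisor_sum (p ^ v * u) + divisor_sum u.
Proof.
move=> pp pu u0; rewrite /divisor_sum mulr_sumr.
have p0 := prime_gt0 pp.
have n0 w : (0 < p ^ w * u)%N by rewrite muln_gt0 expn_gt0 p0.
have E : perm_eq (divisors (p ^ v.+1 * u))
    ([seq (p * d)%N | d <- divisors (p ^ v * u)] ++ divisors u).
  apply: uniq_perm; first exact: divisors_uniq.
    rewrite cat_uniq map_inj_uniq ?divisors_uniq ?andbT //=; last first.
      by move=> x y /eqP; rewrite eqn_pmul2l // => /eqP.
    apply/hasPn => d; rewrite -dvdn_divisors // => du.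
    apply/negP => /mapP[e _ Ed]; move/negP: pu; apply.
    by apply: dvdn_trans du; rewrite Ed dvdn_mulr.
  move=> d; rewrite mem_cat -!dvdn_divisors //.
  apply/idP/orP => [dn|[/mapP[e]|du]].
  - have [/dvdnP[e Ed]|pd] := boolP (p %| d)%N; [left|right].
      rewrite Ed mulnC; apply: map_f; rewrite -dvdn_divisors //.
      by move: dn; rewrite Ed expnS mulnAC mulnC -mulnA dvdn_pmul2l // mulnC.
    by rewrite -(@Gauss_dvdr _ (p ^ v.+1)) // coprimeXr // coprime_sym prime_coprime.
  - by rewrite -dvdn_divisors // => en ->; rewrite expnS -mulnA dvdn_pmul2l.
  - exact: dvdn_mull.
rewrite (perm_big _ E) big_cat big_map /=; congr (_ + _).
by apply: eq_bigr => d _; rewrite (real_charM hchi).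
Qed.

Lemma divisor_sum_prime_power p v u : prime p -> ~~ (p %| u)%N -> (0 < u)%N ->
  divisor_sum (p ^ v * u) = (\sum_(0 <= i < v.+1) chi p ^+ i) * divisor_sum u.
Proof.
move=> pp pu u0; elim: v => [|v IH]; first by rewrite mul1n big_nat1 mul1r.
rewrite divisor_sumSp // IH [in RHS]big_nat_recl // expr0 mulrDl mul1r [RHS]addrC.
rewrite mulrA mulr_sumr; congr (_ * _ + _).
by apply: eq_bigr => i _; rewrite exprS.
Qed.

Lemma geometric_chi p v : \sum_(0 <= i < v.+1) chi p ^+ i =
  if chi p == 0 then 1 else if chi p == 1 then v.+1%:R else (~~ odd v)%:R.
Proof.
elim: v => [|v IH]; first by rewrite big_nat1; case: eqP => //; case: eqP.
rewrite big_nat_recr //= {}IH; case: (real_char_cases p) => ->.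
- by rewrite eqxx expr0n addr0.
- by rewrite /= expr1n natr1.
- by rewrite /= -signr_odd /=; case: (odd v).
Qed.

Lemma divisor_sum_ge0 n : (0 < n)%N -> 0 <= divisor_sum n.
Proof.
move: n; apply: prime_power_ind => [|p v u pp pu u0 IH]; first by rewrite divisor_sum1.
rewrite divisor_sum_prime_power // mulr_ge0 // geometric_chi.
by case: eqP => // _; case: eqP.
Qed.

Lemma divisor_sum_sqr_ge1 k : (0 < k)%N -> 1 <= divisor_sum (k * k).
Proof.
move: k; apply: prime_power_ind => [|p v u pp pu u0 IH]; first by rewrite divisor_sum1.
have -> : (p ^ v.+1 * u * (p ^ v.+1 * u) = p ^ (v.+1 + v.+1) * (u * u))%N.
  by rewrite expnD; ring.
rewrite divisor_sum_prime_power ?muln_gt0 ?u0 ?Euclid_dvdM ?negb_or ?pu //.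
rewrite geometric_chi addnn odd_double -[leLHS]mulr1 ler_pM //.
by case: eqP => // _; case: eqP => // _; rewrite ler1n.
Qed.

(** A prime with [chi p = -1] and odd exponent would make its local factor vanish. So all primes of
    odd exponent have [chi p = 1]; their product is [q], and the square roots of [-m] are glued by
    the Chinese remainder theorem. *)
Lemma divisor_sum_neq0 m n :
  (forall p, prime p -> chi p = 1 -> exists s, (p %| s * s + m)%N) ->
  (0 < n)%N -> coprime n M -> divisor_sum n != 0 ->
  exists k q s, n = (k * k * q)%N /\ (q %| s * s + m)%N.
Proof.
move=> hm; move: n; apply: prime_power_ind => [_ _|p v u pp pu u0 IH].
  by exists 1%N, 1%N, 0%N.
rewrite coprimeMl coprime_pexpl // => /andP[pM uM].
rewrite divisor_sum_prime_power // mulf_eq0 negb_or geometric_chi => /andP[G fu].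
have [k [q [s [Eu qs]]]] := IH uM fu.
have pk : coprime p q.
  by rewrite prime_coprime //; apply: contra pu => pq; rewrite Eu dvdn_mull.
(* The exponent of [p] is [v.+1]: for [v] odd it goes entirely into the square part. *)
have [ov|ev] := boolP (odd v).
  exists (p ^ v.+1./2 * k)%N, q, s; split=> //.
  rewrite -{1}[v.+1]odd_double_half /= ov add0n -addnn expnD Eu; ring.
have cp : chi p = 1.
  by move: G; have [->|->] := real_char_cop hchi pM; rewrite //= negbK (negbTE ev).
have [sp hsp] := hm p pp cp.
exists (p ^ v./2 * k)%N, (p * q)%N, (chinese p q sp s); split.
  rewrite expnS -{1}[v]odd_double_half (negbTE ev) add0n -addnn expnD Eu; ring.
rewrite Gauss_dvd //; apply/andP; split.
  by rewrite /dvdn -modnDml -modnMm chinese_modl // modnMm modnDml.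
by rewrite /dvdn -modnDml -modnMm chinese_modr // modnMm modnDml.
Qed.

End DivisorSum.

(** * Sums over residue classes and non-vanishing of a divisor sum *)

Lemma sum_coprime_mul (V : nmodType) (F : nat -> V) M d : (0 < M)%N ->
  (forall n, F (n + M)%N = F n) -> coprime d M ->
  \sum_(0 <= n < M) F (d * n)%N = \sum_(0 <= n < M) F n.
Proof.
move=> M0 FM dM; rewrite !big_mkord.
pose h (i : 'I_M) := Ordinal (ltn_pmod (d * i) M0).
have h_inj : injective h.
  suff H (i j : 'I_M) : (i <= j)%N -> h i = h j -> i = j.
    by move=> i j E; have [ij|/ltnW ij] := leqP i j; [exact: H | exact/esym/H].
  move=> ij /(congr1 val) /= /eqP; rewrite eq_sym eqn_mod_dvd ?leq_mul2l ?ij ?orbT //.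
  rewrite -mulnBr Gauss_dvdr 1?coprime_sym // => ji.
  apply/val_inj/eqP; rewrite eqn_leq ij leqNgt /= -subn_gt0.
  apply/negP => ji0; have := dvdn_leq ji0 ji; have := ltn_ord j; lia.
rewrite [RHS](reindex_inj h_inj) /=; apply: eq_bigr => i _.
by rewrite (periodic_modn FM).
Qed.

Lemma sum_residue (F : nat -> int) M a : (0 < M)%N ->
  (forall n, F (n + M)%N = F n) ->
  \sum_(0 <= n < M) (n == a %[mod M])%:R * F n = F a.
Proof.
move=> M0 FM; rewrite big_mkord (bigD1 (Ordinal (ltn_pmod a M0))) //= big1 ?addr0.
  by rewrite modn_mod eqxx mul1r (periodic_modn FM).
move=> i ia; case: eqP => [E|]; last by rewrite mul0r.
by case/eqP: ia; apply: val_inj; rewrite /= -E modn_small.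
Qed.

Lemma harmonic_unbounded (R : archiRealFieldType) (C : R) :
  exists J, C < \sum_(1 <= j < J.+1) j%:R^-1.
Proof.
have H n : n%:R / 2 <= \sum_(1 <= j < (2 ^ n).+1) j%:R^-1 :> R.
  elim: n => [|n IH]; first by rewrite mul0r; apply: sumr_ge0 => i _; rewrite invr_ge0 ler0n.
  have n0 : (0 < 2 ^ n)%N by rewrite expn_gt0.
  rewrite (@big_cat_nat _ _ _ (2 ^ n).+1) //=; last by rewrite ltnS leq_exp2l.
  rewrite -natr1 mulrDl; apply: lerD => //; rewrite mul1r.
  apply: (@le_trans _ _ (\sum_((2 ^ n).+1 <= j < (2 ^ n.+1).+1) (2 ^ n.+1)%:R^-1)).
    rewrite sumr_const_nat subSS expnS mul2n -addnn addnK addnn -mul2n.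
    by rewrite -[leRHS]mulr_natr natrM invfM -mulrA mulVf ?mulr1 ?div1r // pnatr_eq0 -lt0n.
  apply: ler_sum_nat => j /andP[j0 j1].
  by rewrite lef_pV2 ?posrE ?ltr0n ?expn_gt0 ?(leq_trans _ j0) // ler_nat.
exists (2 ^ Num.bound `|2 * C|%R)%N.
apply: lt_le_trans (H _).
rewrite ltr_pdivlMr // mulrC; apply: le_lt_trans (ler_norm _) _.
exact: archi_boundP.
Qed.

Lemma sum_pairs_divisor (V : nmodType) (F : nat -> nat -> V) X :
  \sum_(1 <= q < X.+1) \sum_(d <- divisors q) F d q =
  \sum_(1 <= d < X.+1) \sum_(1 <= e < X.+1 | (d * e <= X)%N) F d (d * e)%N.
Proof.
transitivity (\sum_(1 <= q < X.+1) \sum_(1 <= d < X.+1 | (d %| q)%N) F d q).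
  apply: eq_big_nat => q /andP[q0 qX]; rewrite -[RHS]big_filter; apply: perm_big.
  apply: uniq_perm; rewrite ?divisors_uniq ?filter_uniq ?iota_uniq // => d.
  rewrite mem_filter mem_index_iota -dvdn_divisors //.
  have [dq|//] := boolP (d %| q)%N.
  by rewrite (dvdn_gt0 q0 dq) ltnS (leq_trans (dvdn_leq q0 dq)).
rewrite (exchange_big_dep_nat xpredT) //=; apply: eq_big_nat => d /andP[d0 dX].
rewrite -[RHS]big_filter -[RHS](big_map (muln d) xpredT) -big_filter; apply: perm_big.
apply: uniq_perm; rewrite ?filter_uniq ?iota_uniq //.
  rewrite map_inj_uniq ?filter_uniq ?iota_uniq // => x y /eqP.
  by rewrite eqn_pmul2l // => /eqP.
move=> q; rewrite mem_filter mem_index_iota.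
apply/and3P/mapP => [[/dvdnP[e ->] e0 eX]|[e]].
  exists e; last by rewrite mulnC.
  move: e0 eX; rewrite mem_filter mem_index_iota muln_gt0 ltnS => /andP[-> _] eX.
  by rewrite mulnC eX /= ltnS (leq_trans _ eX) // leq_pmulr.
rewrite mem_filter mem_index_iota ltnS => /and3P[de e0 _] ->.
by rewrite dvdn_mulr // muln_gt0 d0 e0.
Qed.

Lemma sum_squares_le (R : numDomainType) (T : nat -> R) N : (forall n, 0 <= T n) ->
  \sum_(1 <= k < N.+1) T (k * k)%N <= \sum_(1 <= q < (N * N).+1) T q.
Proof.
move=> T0; elim: N => [|N IH]; first by rewrite !big_geq.
rewrite big_nat_recr //= [leRHS](@big_cat_nat _ _ _ (N * N).+1) //=; last by rewrite ltnS; apply: leq_mul.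
apply: lerD => //; rewrite big_nat_recr /=; last by apply: ltn_mul.
by rewrite lerDr sumr_ge0.
Qed.

(* Otherwise test the weights [divisor_sum q / sqrt q] against the function [g],
   supported on units, which sums to zero against both 1 and [chi]: by the
   hyperbola method the result is bounded, but away from the class of [a] all terms
   have the same sign, and the squares alone contribute a divergent harmonic series. *)
Lemma exists_divisor_sum_neq0 M chi a b : (0 < M)%N -> real_char M chi ->
  chi b = -1 -> chi a = 1 ->
  exists q, [/\ (0 < q)%N, q = a %[mod M] & divisor_sum chi q != 0].
Proof.
move=> M0 hchi cb ca; pose R := realalg.
have copP n : chi n != 0 -> coprime n M.
  by apply: contraR => /(real_char_ncop hchi) ->.
have aM : coprime a M by rewrite copP // ca.
have bM : coprime b M by rewrite copP // cb.
pose c (n : nat) : int := (coprime n M)%:R.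
have c0 n : ~~ coprime n M -> c n = 0 by rewrite /c => /negbTE ->.
have c1 n : coprime n M -> c n = 1 by rewrite /c => ->.
have cM n : c (n + M)%N = c n by rewrite /c -coprime_modl modnDr coprime_modl.
have c2 n : chi n * chi n = c n.
  have [nM|nM] := boolP (coprime n M); last by rewrite (real_char_ncop hchi nM) c0.
  by rewrite c1 //; have [->|->] := real_char_cop hchi nM.
have cchi n : c n * chi n = chi n.
  have [nM|nM] := boolP (coprime n M); first by rewrite c1 ?mul1r.
  by rewrite (real_char_ncop hchi nM) mulr0.
have cM' n d : coprime d M -> c (d * n)%N = c n.
  by move=> dM; rewrite /c coprimeMl dM.
have chi_sum0 : \sum_(0 <= n < M) chi n = 0.
  have := sum_coprime_mul M0 (real_charD hchi) bM.
  under eq_bigr do rewrite (real_charM hchi) cb mulN1r.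
  by rewrite sumrN => /eqP; rewrite eqNr => /eqP.
(* Euler's totient of [M]. This factor makes [g] sum to zero, and with [chi a = 1] also
   [chi * g]. *)
pose phi : int := \sum_(0 <= n < M) c n.
pose g (n : nat) : int := phi * (n == a %[mod M])%:R - (c n + chi n).
have gM n : g (n + M)%N = g n by rewrite /g modnDr cM (real_charD hchi).
have g0 n : ~~ coprime n M -> g n = 0.
  move=> nM; rewrite /g c0 // (real_char_ncop hchi nM) addr0.
  case: eqP => [E|]; last by rewrite mulr0.
  by move: nM; rewrite -coprime_modl E coprime_modl aM.
have g_sum : \sum_(0 <= n < M) g n = 0.
  rewrite sumrB big_split /= chi_sum0 addr0 -mulr_sumr.
  rewrite (_ : \sum_(_ <= _ < _) _ = 1) ?mulr1 ?subrr //.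
  rewrite -[RHS](@sum_residue (fun=> 1) M a M0 (fun=> erefl)).
  by apply: eq_bigr => n _; rewrite mulr1.
have gchi_sum : \sum_(0 <= n < M) chi n * g n = 0.
  transitivity (phi * (\sum_(0 <= n < M) (n == a %[mod M])%:R * chi n)
      - (\sum_(0 <= n < M) chi n + \sum_(0 <= n < M) c n)).
    rewrite mulr_sumr -big_split -sumrB; apply: eq_bigr => n _ /=.
    by rewrite -[in RHS]c2 -[X in _ = _ - (X + _)]cchi /g; ring.
  by rewrite (sum_residue _ M0 (real_charD hchi)) ca chi_sum0 add0r mulr1 subrr.
(* Summing [K] over [d * e = q] gives [divisor_sum chi q * g q]. *)
pose K d e : R := (chi d * g (d * e)%N)%:~R.
have [] := @hyperbola_bound R K M (`|phi| + 2)%:~R M0.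
- move=> d e; rewrite /K (real_charD hchi) -(periodic_modn gM).
  by rewrite mulnDl addnC [(M * e)%N]mulnC modnMDl (periodic_modn gM).
- by move=> d e; rewrite /K -(periodic_modn gM) mulnDr addnC modnMDl (periodic_modn gM).
- move=> e; rewrite /K -raddf_sum /=; have [eM|eM] := boolP (coprime e M); last first.
    by rewrite big1 // => d _; rewrite g0 ?mulr0 // coprimeMl (negbTE eM) andbF.
  have := @sum_coprime_mul int (fun n => chi n * g n) M e M0 _ eM.
  rewrite gchi_sum => /(_ (fun n => _)) E.
  rewrite (_ : \sum_(_ <= _ < _) _ = chi e * \sum_(0 <= d < M) chi (e * d)%N * g (e * d)%N).
    by rewrite E ?mulr0 // => n; rewrite gM (real_charD hchi).
  rewrite mulr_sumr; apply: eq_bigr => d _.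
  by rewrite (real_charM hchi) !mulrA c2 c1 // mul1r mulnC.
- move=> d; rewrite /K -raddf_sum /= -mulr_sumr.
  have [dM|dM] := boolP (coprime d M); last by rewrite (real_char_ncop hchi dM) mul0r.
  by rewrite sum_coprime_mul // g_sum mulr0.
- move=> d e; rewrite /K -intr_norm ler_int normrM.
  have : `|g (d * e)%N| <= `|phi| + 2.
    rewrite /g; apply: le_trans (ler_normB _ _) _; apply: lerD.
      by rewrite normrM ler_piMr //; case: eqP.
    rewrite /c; case: (coprime _ _); have [->|->|->] := real_char_cases hchi (d * e) => //.
  by have [->|->|->] := real_char_cases hchi d; lia.
move=> C hC.
have [J hJ] := harmonic_unbounded (C * M%:R : R).
pose N := (J * M).+1; pose f := divisor_sum chi.
pose T n : R := (f n * (c n + chi n))%:~R * isqrt R n.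
have T0 n : 0 <= T n.
  have [->|n0] := posnP n; first by rewrite /T /isqrt sqrtr0 invr0 mulr0.
  rewrite mulr_ge0 ?isqrt_ge0 // ler0z mulr_ge0 ?(divisor_sum_ge0 hchi) //.
  have [nM|nM] := boolP (coprime n M); [rewrite c1 // | rewrite c0 //].
    by have [->|->] := real_char_cop hchi nM.
  by rewrite (real_char_ncop hchi nM).
have [/hasP[q]|/hasPn H] :=
    boolP (has (fun q => (q == a %[mod M]) && (f q != 0)) (index_iota 1 (N * N).+1)).
  by rewrite mem_index_iota => /andP[q0 _] /andP[/eqP qa fq]; exists q.
exfalso.
have := hC N isT.
(* By [H], the term of [g] supported on the class of [a] always meets a zero divisor sum. *)
rewrite (_ : \sum_(_ <= _ < _) _ = - \sum_(1 <= q < (N * N).+1) T q); last first.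
  have := sum_pairs_divisor (fun d q => (chi d * g q)%:~R * isqrt R q) (N * N).
  under [in X in _ = X -> _]eq_bigr => d _ do under eq_bigr => e _ do rewrite isqrtM.
  move=> <-; rewrite -sumrN; apply: eq_big_nat => q hq.
  rewrite -mulr_suml -raddf_sum /= -mulr_suml /T -mulNr -rmorphN /= /g.
  rewrite -[\sum_(_ <- _) _]/(f q).
  have := H q; rewrite mem_index_iota hq => /(_ isT).
  rewrite negb_and negbK => /orP[/negbTE ->|/eqP ->]; last by rewrite !mul0r.
  by rewrite mulr0 add0r mulrN.
rewrite normrN ger0_norm ?sumr_ge0 //.
apply/negP; rewrite -ltNge; apply: lt_le_trans (sum_squares_le N T0).
have M0R : 0 < M%:R :> R by rewrite ltr0n.
rewrite -(ltr_pM2r M0R); apply: lt_le_trans hJ _.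
have TS k : (0 < k)%N -> coprime k M -> k%:R^-1 <= T (k * k)%N.
  move=> k0 kM; rewrite /T isqrt_sqr -[leLHS]mul1r ler_wpM2r ?invr_ge0 //.
  rewrite c1 ?coprimeMl ?kM // (real_charM hchi) c2 c1 // ler1z.
  by have := divisor_sum_sqr_ge1 hchi k0; rewrite -/(f _); lia.
have term_ge0 k : 0 <= T (k * k)%N * M%:R by rewrite mulr_ge0 ?T0 ?ler0n.
rewrite mulr_suml /N [leRHS]big_nat_recr //= -[leLHS]addr0 lerD //.
(* Each block of [M] consecutive integers starts with the unit [j * M + 1], whose square alone
   contributes at least [1 / (j + 1)] after multiplication by [M]. *)
elim: (J) => [|j IH]; first by rewrite big_geq ?sumr_ge0.
have lo : ((j * M).+1 < (j.+1 * M).+1)%N by rewrite ltnS ltn_pmul2r.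
rewrite [leLHS]big_nat_recr //= [leRHS](@big_cat_nat _ _ _ (j * M).+1) ?(ltnW lo) //=.
apply: lerD => //; rewrite big_ltn // -[leLHS]addr0 lerD ?sumr_ge0 //.
have kM : coprime (j * M).+1 M by rewrite -addn1 -coprime_modl modnMDl coprime_modl coprime1n.
apply: (@le_trans _ _ ((j * M).+1%:R^-1 * M%:R)); last first.
  by rewrite ler_wpM2r ?ler0n ?TS.
rewrite mulrC ler_pdivlMr ?ltr0n // mulrC ler_pdivrMr ?ltr0n // -natrM ler_nat.
by move: M0; lia.
Qed.

(** * Quadratic reciprocity *)

Lemma finField_prim_root (F : finFieldType) : exists z : F, (#|F|.-1).-primitive_root z.
Proof.
have F1 := finNzRing_gt1 F.
have n0 : (0 < #|F|.-1)%N by rewrite -ltnS prednK // ltnW.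
pose rs := [seq x <- enum F | x != 0].
have [|||z _ hz] := hasP (@has_prim_root F _ rs n0 _ _ _); last by exists z.
- apply/allP => x; rewrite mem_filter => /andP[x0 _].
  by apply/unity_rootP/(mulfI x0); rewrite -exprS prednK ?mulr1 ?expf_card // ltnW.
- by rewrite filter_uniq ?enum_uniq.
- rewrite -(leq_add2l 1) add1n prednK; last exact: ltnW.
  rewrite cardE -(count_predC (fun x : F => x == 0) (enum F)) size_filter leq_add2r.
  by rewrite -/(count_mem 0 _) count_uniq_mem ?enum_uniq // mem_enum.
Qed.

(** By Euler's theorem [n] divides [q ^ totient n - 1], the order of a cyclic multiplicative
    group. *)
Lemma prim_root_char (q n : nat) : prime q -> (0 < n)%N -> coprime q n ->
  exists (F : finFieldType) (z : F), q \in [pchar F] /\ n.-primitive_root z.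
Proof.
move=> pq n0 qn.
have t0 : (0 < totient n)%N by rewrite totient_gt0.
have [F qF cF] := pPrimePowerField pq t0.
have [z hz] := finField_prim_root F.
have nF : (n %| #|F|.-1)%N.
  rewrite cF -subn1 -eqn_mod_dvd ?expn_gt0 ?prime_gt0 //.
  by apply/eqP; rewrite Euler_exp_totient.
by exists F, (z ^+ (#|F|.-1 %/ n)); split=> //; apply: dvdn_prim_root.
Qed.

(** Lifts identities between symbols, computed in a field of characteristic other than 2, to the
    integers. *)
Lemma unit_int_inj (F : fieldType) (a b : int) : -1 != 1 :> F ->
  [\/ a = 0, a = 1 | a = -1] -> [\/ b = 0, b = 1 | b = -1] -> a%:~R = b%:~R :> F -> a = b.
Proof.
move=> n1 + + /eqP; rewrite -subr_eq0.
by do 2![case=> ->]; rewrite -?intrB //= ?oppr_eq0 ?oner_eq0 //;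
  rewrite ?rmorphN /= ?opprK -?[(1 + 1)%:~R]/(1 + 1) ?intrD ?addr_eq0 // 1?eq_sym (negbTE n1).
Qed.

(** Euler's criterion taken as definition: for odd [#|F|] the exponent is [(#|F| - 1) / 2]. The link
    with squares is [quad_char_square]. *)
Definition quad_char (F : finFieldType) (x : F) : int :=
  if x == 0 then 0 else if x ^+ #|F|./2 == 1 then 1 else -1.

Section QuadraticCharacter.
Variable F : finFieldType.
Hypothesis oddF : odd #|F|.
Implicit Types x y : F.
Notation lam := (@quad_char F).

Lemma half_card_gt0 : (0 < #|F|./2)%N.
Proof. by have := finNzRing_gt1 F; move: oddF; case: #|F| => [|[|[|n]]]. Qed.

Lemma expf_half x : x != 0 -> x ^+ #|F|./2 = 1 \/ x ^+ #|F|./2 = -1.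
Proof.
move=> x0; have : x ^+ #|F|./2.*2 = 1.
  apply: (mulfI x0); rewrite -exprS mulr1 -[RHS]expf_card.
  by rewrite -[in RHS](odd_double_half #|F|) oddF.
rewrite -muln2 exprM => /eqP; rewrite sqrf_eq1 => /orP[]/eqP; by [left|right].
Qed.

Lemma quad_charE x : (lam x)%:~R = x ^+ #|F|./2.
Proof.
rewrite /quad_char; have [->|x0] := eqVneq x 0.
  by rewrite expr0n gtn_eqF ?half_card_gt0.
by case: eqP => [->//|]; have [->|->] := expf_half x0.
Qed.

Lemma quad_char_cases x : x != 0 -> lam x = 1 \/ lam x = -1.
Proof. by rewrite /quad_char => /negbTE ->; case: eqP; by [left|right]. Qed.

Lemma quad_char0 : lam 0 = 0.
Proof. by rewrite /quad_char eqxx. Qed.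

Lemma quad_char1 : lam 1 = 1.
Proof. by rewrite /quad_char oner_eq0 expr1n eqxx. Qed.

Lemma quad_char_neq0 x : (lam x != 0) = (x != 0).
Proof.
have [->|x0] := eqVneq x 0; first by rewrite quad_char0 eqxx.
by have [->|->] := quad_char_cases x0.
Qed.

Lemma quad_char_cases0 x : [\/ lam x = 0, lam x = 1 | lam x = -1].
Proof.
have [->|x0] := eqVneq x 0; first by rewrite quad_char0; constructor 1.
by have [->|->] := quad_char_cases x0; [constructor 2 | constructor 3].
Qed.

Lemma finField_prim_half : exists z : F,
  [/\ z ^+ #|F|./2 = -1, -1 != 1 :> F & forall x, x != 0 -> exists i, x = z ^+ i].
Proof.
have [z hz] := finField_prim_root F; exists z.
have zn1 : z ^+ #|F|./2 != 1.
  rewrite -(prim_order_dvd hz); apply/negP => /(dvdn_leq half_card_gt0).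
  rewrite -{1}(odd_double_half #|F|) oddF /=; have := half_card_gt0; lia.
have z0 : z != 0.
  apply/eqP => z0; move: (prim_expr_order hz).
  by rewrite z0 expr0n gtn_eqF ?(prim_order_gt0 hz) // => /esym/eqP; rewrite oner_eq0.
have [E|E] := expf_half z0; first by rewrite E eqxx in zn1.
split=> // [|x x0]; first by rewrite -E.
have x1 : x ^+ #|F|.-1 = 1.
  by apply: (mulfI x0); rewrite -exprS prednK ?mulr1 ?expf_card // ltnW ?finNzRing_gt1.
by have [i Ei] := prim_rootP hz x1; exists i.
Qed.

Lemma oppr1_neq1 : -1 != 1 :> F.
Proof. by have [z []] := finField_prim_half. Qed.

Lemma quad_charM x y : lam (x * y) = lam x * lam y.
Proof.
apply: (unit_int_inj oppr1_neq1); first exact: quad_char_cases0.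
  have [->|->|->] := quad_char_cases0 x; have [->|->|->] := quad_char_cases0 y;
    by [constructor 1 | constructor 2 | constructor 3].
by rewrite intrM !quad_charE exprMn.
Qed.

Lemma quad_char_square x : lam x = 1 -> exists y, y * y = x.
Proof.
move=> lx; have x0 : x != 0 by rewrite -quad_char_neq0 lx.
have [z [zh n1 zx]] := finField_prim_half.
have [i Ei] := zx x x0; exists (z ^+ i./2); rewrite -exprD addnn Ei.
suff /negbTE oi : ~~ odd i by rewrite -[in RHS](odd_double_half i) oi.
apply/negP => oi; move: (quad_charE x); rewrite lx Ei -exprM mulnC exprM zh => /eqP.
by rewrite -signr_odd oi expr1 eq_sym (negbTE n1).
Qed.

Lemma quad_char_nonsquare : exists y, lam y = -1.
Proof.
have [z [zh n1 _]] := finField_prim_half; exists z.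
rewrite /quad_char zh (negbTE n1); case: eqP => // z0.
move: zh; rewrite z0 expr0n gtn_eqF ?half_card_gt0 // => /esym/eqP.
by rewrite oppr_eq0 oner_eq0.
Qed.

Lemma sum_quad_char : \sum_(x : F) lam x = 0.
Proof.
have [y ly] := quad_char_nonsquare.
have y0 : y != 0 by rewrite -quad_char_neq0 ly.
have : \sum_(x : F) lam x = - \sum_(x : F) lam x.
  rewrite {1}(reindex_inj (mulfI y0)) -sumrN.
  by apply: eq_bigr => x _; rewrite quad_charM ly mulN1r.
by move/eqP; rewrite eq_sym eqNr => /eqP.
Qed.

Lemma quad_charN1 : lam (-1) = (-1) ^+ #|F|./2.
Proof.
apply: (unit_int_inj oppr1_neq1); first exact: quad_char_cases0.
  by rewrite -signr_odd; case: (odd _); [constructor 3 | constructor 2].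
by rewrite quad_charE rmorphXn.
Qed.

End QuadraticCharacter.

Definition legendre (p a : nat) : int := quad_char (a%:R : 'F_p).

Lemma legendre_pchar (q a : nat) (L : fieldType) : prime q -> odd q -> q \in [pchar L] ->
  (legendre q a)%:~R = a%:R ^+ q./2 :> L.
Proof.
move=> pq q2 qL; have oddFq : odd #|'F_q| by rewrite card_Fp.
have zE n : (n%:R == 0 :> L) = (n%:R == 0 :> 'F_q).
  by rewrite -(dvdn_pcharf qL) -(dvdn_pcharf (pchar_Fp pq)).
have := quad_charE oddFq (a%:R : 'F_q); rewrite card_Fp // -!natrX /legendre.
have [->|->|->] := quad_char_cases0 (a%:R : 'F_q) => /esym/eqP.
- by rewrite -zE => /eqP.
- have [a0|a0] := posnP (a ^ q./2).
    by rewrite a0 eq_sym oner_eq0.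
  by rewrite -subr_eq0 -natrB // -zE natrB // subr_eq0 => /eqP.
- by rewrite rmorphN /= -addr_eq0 -(natrD _ _ 1) -zE natrD addr_eq0 rmorphN => /eqP.
Qed.

(** * Quadratic Gauss sums in characteristic [q] *)

Section GaussSum.
Variables (p q : nat).
Hypotheses (pp : prime p) (p2 : odd p) (pq : prime q) (q2 : odd q) (neq : p != q).
Variables (L : finFieldType) (z : L).
Hypotheses (qL : q \in [pchar L]) (hz : p.-primitive_root z).
Notation lam := (@quad_char 'F_p).
Let e (x : 'F_p) : L := z ^+ val x.

Let oddFp : odd #|'F_p|. Proof. by rewrite card_Fp. Qed.

Let eD x y : e (x + y) = e x * e y.
Proof.
have mE m : (m %% (Zp_trunc (pdiv p)).+2 = m %% p)%N by rewrite Fp_cast.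
by rewrite /e -exprD; apply/eqP; rewrite (eq_prim_root_expr hz) /= mE modn_mod.
Qed.

Let e0 : e 0 = 1. Proof. by rewrite /e expr0. Qed.

Let e1_neq1 : e 1 != 1.
Proof.
have := prim_order_dvd hz 1; rewrite dvdn1 expr1.
by rewrite /e [val _]modn_small ?Fp_cast ?prime_gt1 // expr1 => <-; rewrite gtn_eqF ?prime_gt1.
Qed.

Let e_nat n x : e (n%:R * x) = e x ^+ n.
Proof.
by elim: n => [|n IH]; rewrite ?mul0r ?e0 // -natr1 mulrDl mul1r eD IH exprSr.
Qed.

Let e_sum c : c != 0 -> \sum_x e (c * x) = 0.
Proof.
move=> c0; transitivity (\sum_x e x); first by rewrite [RHS](reindex_inj (mulfI c0)).
have : e 1 * \sum_x e x = \sum_x e x.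
  rewrite mulr_sumr [RHS](reindex_inj (addrI 1)).
  by apply: eq_bigr => x _; rewrite eD.
by move/eqP; rewrite -subr_eq0 -{2}[\sum_x e x]mul1r -mulrBl mulf_eq0 subr_eq0 (negbTE e1_neq1) => /eqP.
Qed.

Definition gauss_sum : L := \sum_x (lam x)%:~R * e x.

(** Put [y = x * t] in the double sum. The sum over [x != 0] is then [p - 1] for [t = -1] and [-1]
    otherwise, and the values of [lam] sum to zero. *)
Lemma gauss_sum_sqr : gauss_sum ^+ 2 = (lam (-1))%:~R * p%:R.
Proof.
rewrite expr2 /gauss_sum mulr_suml.
transitivity (\sum_(x | x != 0) \sum_t (lam t)%:~R * e (x * (1 + t))).
  rewrite (bigD1 0) //= quad_char0 !mul0r add0r; apply: eq_bigr => x x0.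
  rewrite mulr_sumr (reindex_inj (mulfI x0)); apply: eq_bigr => t _.
  rewrite mulrDr mulr1 eD (quad_charM oddFp) intrM.
  have := quad_charM oddFp x x; have [->|->] := quad_char_cases x0; by move=> _; ring.
rewrite exchange_big (bigD1 (-1)) //=.
rewrite [X in _ + X](eq_bigr (fun t => - (lam t)%:~R)) => [|t t1].
  have := congr1 (fun i : int => i%:~R : L) (sum_quad_char oddFp).
  rewrite (bigD1 (-1)) //= intrD rmorph_sum /= sumrN => /eqP.
  rewrite addr_eq0 => /eqP <-.
  rewrite (eq_bigr (fun=> (lam (-1))%:~R)) => [|x _]; last by rewrite subrr mulr0 e0 mulr1.
  rewrite sumr_const (eq_card (_ : _ =i predC1 0)) // cardC1 card_Fp //.
  by rewrite -mulrSr prednK ?prime_gt0 // mulr_natr.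
rewrite -mulr_sumr.
have t0 : 1 + t != 0 by rewrite addrC addr_eq0.
have := e_sum t0; rewrite (bigD1 0) //= mulr0 e0 => /eqP.
rewrite addrC addr_eq0 => /eqP E.
rewrite (eq_bigr (fun x => e ((1 + t) * x))) => [|x _]; last by rewrite mulrC.
by rewrite E mulrN1.
Qed.

Lemma gauss_sum_frobenius : gauss_sum ^+ q = (lam q%:R)%:~R * gauss_sum.
Proof.
have q0 : q%:R != 0 :> 'F_p.
  by rewrite -(dvdn_pcharf (pchar_Fp pp)) dvdn_prime2.
rewrite -(pFrobenius_autE qL) rmorph_sum /= mulr_sumr.
rewrite [RHS](reindex_inj (mulfI q0)); apply: eq_bigr => x _.
rewrite rmorphM rmorph_int /= pFrobenius_autE e_nat (quad_charM oddFp) intrM.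
by have [->|->] := quad_char_cases q0; ring.
Qed.

(** Frobenius gives [gauss_sum ^+ q.-1] as the symbol of [q] modulo [p]; as a power of
    [gauss_sum ^+ 2] it is, by Euler's criterion, a sign times that of [p] modulo [q]. *)
Lemma gauss_sum_reciprocity :
  legendre q p = (-1) ^+ (p./2 * q./2) * legendre p q.
Proof.
have n1 : -1 != 1 :> L.
  rewrite eq_sym -addr_eq0 -[1 + 1]/(2%:R) -(dvdn_pcharf qL) dvdn_prime2 //.
  by apply: contraTneq q2 => ->.
have q0 : q%:R != 0 :> 'F_p by rewrite -(dvdn_pcharf (pchar_Fp pp)) dvdn_prime2.
have s2 : gauss_sum ^+ 2 != 0.
  rewrite gauss_sum_sqr mulf_neq0 //; last by rewrite -(dvdn_pcharf qL) dvdn_prime2 // eq_sym.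
  have N0 : -1 != 0 :> 'F_p by rewrite oppr_eq0 oner_eq0.
  by have [->|->] := quad_char_cases N0; rewrite ?rmorphN1 ?oppr_eq0 oner_eq0.
have g0 : gauss_sum != 0 by move: s2; rewrite sqrf_eq0.
have oddFq : odd #|'F_q| by rewrite card_Fp.
have E : (gauss_sum ^+ 2) ^+ q./2 = (lam q%:R)%:~R.
  apply: (mulIf g0); rewrite -gauss_sum_frobenius -exprM -exprSr mul2n.
  by rewrite -[in RHS](odd_double_half q) q2.
apply: (unit_int_inj n1); first exact: quad_char_cases0.
  rewrite /legendre; have [->|->] := quad_char_cases q0; rewrite -signr_odd; case: (odd _);
    by [constructor 2 | constructor 3].
rewrite (legendre_pchar p pq q2 qL) intrM -E gauss_sum_sqr exprMn quad_charN1 // card_Fp //.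
rewrite !rmorphXn /= rmorphN1 -exprM mulrA -expr2 -exprM mulnC exprM sqrrN expr1n expr1n mul1r.
by [].
Qed.

End GaussSum.

(** At odd primes, [chi4] and [chi8] are the Legendre symbols of -1 and 2. *)
Definition chi4 (n : nat) : int :=
  if (n %% 4 == 1)%N then 1 else if (n %% 4 == 3)%N then -1 else 0.

Definition chi8 (n : nat) : int :=
  if (n %% 8 == 1)%N || (n %% 8 == 7)%N then 1 else
  if (n %% 8 == 3)%N || (n %% 8 == 5)%N then -1 else 0.

Lemma real_char_chi4 : real_char 4 chi4.
Proof.
split=> //.
- move=> m n; rewrite /chi4 -modnMm; move: (m %% 4)%N (n %% 4)%N (ltn_pmod m (isT : 0 < 4)%N)
    (ltn_pmod n (isT : 0 < 4)%N) => x y.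
  by move: x y => [|[|[|[|x]]]] [|[|[|[|y]]]].
- by move=> n; rewrite /chi4 modnDr.
- move=> n; rewrite /chi4 -coprime_modl; move: (n %% 4)%N (ltn_pmod n (isT : 0 < 4)%N) => x.
  by move: x => [|[|[|[|x]]]] // _ _; [left|right].
- move=> n; rewrite /chi4 -coprime_modl; move: (n %% 4)%N (ltn_pmod n (isT : 0 < 4)%N) => x.
  by move: x => [|[|[|[|x]]]].
Qed.

Lemma real_char_chi8 : real_char 8 chi8.
Proof.
split=> //.
- move=> m n; rewrite /chi8 -modnMm; move: (m %% 8)%N (n %% 8)%N (ltn_pmod m (isT : 0 < 8)%N)
    (ltn_pmod n (isT : 0 < 8)%N) => x y.
  by move: x y => [|[|[|[|[|[|[|[|x]]]]]]]] [|[|[|[|[|[|[|[|y]]]]]]]].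
- by move=> n; rewrite /chi8 modnDr.
- move=> n; rewrite /chi8 -coprime_modl; move: (n %% 8)%N (ltn_pmod n (isT : 0 < 8)%N) => x.
  by move: x => [|[|[|[|[|[|[|[|x]]]]]]]] // _ _; by [left|right].
- move=> n; rewrite /chi8 -coprime_modl; move: (n %% 8)%N (ltn_pmod n (isT : 0 < 8)%N) => x.
  by move: x => [|[|[|[|[|[|[|[|x]]]]]]]].
Qed.

Lemma real_charMM M1 M2 chi1 chi2 : real_char M1 chi1 -> real_char M2 chi2 ->
  real_char (M1 * M2) (fun n => chi1 n * chi2 n).
Proof.
move=> h1 h2; split.
- by rewrite (real_char1 h1) (real_char1 h2).
- by move=> m n; rewrite (real_charM h1) (real_charM h2); ring.
- move=> n; congr (_ * _).
    by rewrite -(periodic_modn (real_charD h1)) addnC mulnC modnMDl (periodic_modn (real_charD h1)).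
  by rewrite -(periodic_modn (real_charD h2)) addnC modnMDl (periodic_modn (real_charD h2)).
- move=> n; rewrite coprimeMr => /andP[n1 n2].
  by have [->|->] := real_char_cop h1 n1; have [->|->] := real_char_cop h2 n2; by [left|right].
- move=> n; rewrite coprimeMr negb_and => /orP[n1|n2].
    by rewrite (real_char_ncop h1 n1) mul0r.
  by rewrite (real_char_ncop h2 n2) mulr0.
Qed.

Lemma sign_half_chi4 n : odd n -> (-1) ^+ n./2 = chi4 n.
Proof.
move=> on; rewrite /chi4 -signr_odd.
have : (n %% 4 = (odd n./2).*2.+1)%N by lia.
by move=> ->; case: (odd _).
Qed.

Section Legendre.
Variable p : nat.
Hypotheses (pp : prime p) (p2 : odd p).

Let oddFp : odd #|'F_p|. Proof. by rewrite card_Fp. Qed.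

Lemma natFp_eq0 n : (n%:R == 0 :> 'F_p) = (p %| n)%N.
Proof. by rewrite -(dvdn_pcharf (pchar_Fp pp)). Qed.

Lemma real_char_legendre : real_char p (legendre p).
Proof.
split.
- exact: quad_char1.
- by move=> m n; rewrite /legendre natrM quad_charM.
- by move=> n; rewrite /legendre natrD (pchar_Fp_0 pp) addr0.
- move=> n; rewrite coprime_sym prime_coprime // -natFp_eq0; exact: quad_char_cases.
- move=> n; rewrite coprime_sym prime_coprime // negbK -natFp_eq0 => /eqP E.
  by rewrite /legendre E quad_char0.
Qed.

Lemma quad_charN1_Fp : quad_char (-1 : 'F_p) = chi4 p.
Proof. by rewrite quad_charN1 // card_Fp // sign_half_chi4. Qed.

(** Symbols take arguments in [nat], so -1 is represented by such a [d]. *)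
Lemma legendre_predn d : (p %| d.+1)%N -> legendre p d = chi4 p.
Proof.
by rewrite -natFp_eq0 -natr1 addr_eq0 => /eqP E; rewrite /legendre E quad_charN1_Fp.
Qed.

Lemma legendre_opp_square m : chi4 p * legendre p m = 1 -> exists s, (p %| s * s + m)%N.
Proof.
rewrite -quad_charN1_Fp /legendre -quad_charM // => /(quad_char_square oddFp)[y Ey].
exists (val y); rewrite -natFp_eq0 natrD natrM.
by rewrite (natr_Zp y) Ey mulN1r addNr.
Qed.

Lemma legendre2 : legendre p 2 = chi8 p.
Proof.
have p8 : coprime p 8 by rewrite (@coprimeXr 3 p 2) // coprimen2.
have [L [z [pL hz]]] := prim_root_char pp (isT : (0 < 8)%N) p8.
have z8 := prim_expr_order hz.
have z4 : z ^+ 4 = -1.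
  have /eqP : (z ^+ 4) ^+ 2 = 1 by rewrite -exprM.
  by rewrite sqrf_eq1 -(prim_order_dvd hz) => /orP[//|/eqP].
have n1 : -1 != 1 :> L by rewrite -z4 -(prim_order_dvd hz).
have L2 : (2 : L) != 0 by rewrite (_ : 2 = 1 + 1) // addr_eq0 eq_sym.
(* Since [z ^+ 4 = -1], this is [z] plus its inverse, a square root of 2; Frobenius multiplies it by
   [chi8 p]. *)
pose tau : L := z - z ^+ 3.
have tau2 : tau ^+ 2 = 2.
  have -> : tau ^+ 2 = z ^+ 2 * (1 + z ^+ 4) - 2 * z ^+ 4 by rewrite /tau; ring.
  by rewrite z4; ring.
have tau0 : tau != 0 by apply: contra_neq L2 => E; rewrite -tau2 E expr0n.
have taup : tau ^+ p = (chi8 p)%:~R * tau.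
  rewrite -(pFrobenius_autE pL) rmorphB /= !pFrobenius_autE exprAC.
  rewrite -(prim_expr_mod hz) /chi8.
  have : (p %% 8)%N \in [:: 1; 3; 5; 7]%N by rewrite !inE; lia.
  rewrite !inE => /or4P[] /eqP -> /=; rewrite /tau.
  - ring.
  - have -> : (z ^+ 3) ^+ 3 = z ^+ 4 * z ^+ 4 * z by ring.
    by rewrite z4; ring.
  - have -> : (z ^+ 5) ^+ 3 = z ^+ 4 * z ^+ 4 * z ^+ 4 * z ^+ 3 by ring.
    by rewrite (exprS z 4) z4; ring.
  - have -> : (z ^+ 7) ^+ 3 = z ^+ 4 * z ^+ 4 * z ^+ 4 * z ^+ 4 * z ^+ 4 * z by ring.
    by rewrite (exprD z 4 3) z4; ring.
apply: (unit_int_inj n1); first exact: quad_char_cases0.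
  exact: (real_char_cases real_char_chi8).
rewrite (legendre_pchar 2 pp p2 pL) -tau2 -exprM; apply: (mulIf tau0).
rewrite -taup -exprSr mul2n; congr (_ ^+ _).
by rewrite -[RHS](odd_double_half p) p2.
Qed.

End Legendre.

Lemma quadratic_reciprocity p q : prime p -> odd p -> prime q -> odd q -> p != q ->
  legendre q p = (-1) ^+ (p./2 * q./2) * legendre p q.
Proof.
move=> pp p2 pq q2 neq.
have qp : coprime q p by rewrite prime_coprime // dvdn_prime2 // eq_sym.
have [L [z [qL hz]]] := prim_root_char pq (prime_gt0 pp) qp.
exact: (gauss_sum_reciprocity pp p2 pq q2 neq qL hz).
Qed.

(** * Sums of three squares *)

(* [J] is the Jacobi symbol [(_ / m)]. *)
Record jacobi_spec (m : nat) (J : nat -> int) : Prop := JacobiSpec {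
  jacobi_char : real_char m J;
  jacobi_predn : forall d, (m %| d.+1)%N -> J d = chi4 m;
  jacobi2 : J 2%N = chi8 m;
  jacobi_reciprocity : forall l, prime l -> odd l -> coprime l m ->
    legendre l m = chi4 m ^+ l./2 * J l }.

(** A product of Legendre symbols over the prime factors of [m]: every clause is multiplicative in
    [m]. *)
Lemma jacobi_exists m : odd m -> exists J, jacobi_spec m J.
Proof.
elim/ltn_ind: m => m IH om.
have [->|m1] := eqVneq m 1%N.
  exists (fun=> 1); split=> //.
  - by split=> // n; [left | rewrite coprimen1].
  - by move=> l pl l2 _; rewrite expr1n mulr1 (real_char1 (real_char_legendre pl l2)).
have m2 : (1 < m)%N by rewrite ltn_neqAle eq_sym m1 odd_gt0.
have pp := pdiv_prime m2; set p := pdiv m in pp.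
have [u Em] : exists u, m = (p * u)%N.
  by have /dvdnP[u ->] := pdiv_dvd m; exists u; rewrite mulnC.
have /andP[p2 u2] : odd p && odd u by rewrite -oddM -Em.
have u_lt : (u < m)%N by rewrite Em -[ltnLHS]mul1n ltn_pmul2r ?prime_gt1 ?odd_gt0.
have [J [J1 J2 J3 J4]] := IH u u_lt u2.
exists (fun n => legendre p n * J n); rewrite Em; split.
- exact/real_charMM/J1/real_char_legendre.
- move=> d pu; rewrite (real_charM real_char_chi4).
  by rewrite legendre_predn ?(dvdn_trans _ pu) ?dvdn_mulr // J2 // (dvdn_trans _ pu) ?dvdn_mull.
- by rewrite legendre2 // J3 (real_charM real_char_chi8).
- move=> l pl l2; rewrite coprimeMr => /andP[lp lu].
  rewrite (real_charM (real_char_legendre pl l2)) J4 // (real_charM real_char_chi4) exprMn.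
  have neq : p != l by apply: contraTneq lp => ->; rewrite prime_coprime // dvdnn.
  by rewrite quadratic_reciprocity // exprM sign_half_chi4 //; ring.
Qed.

(* [chi] is the character [(-m / _)], and [-t a] is a square modulo [m]. *)
Lemma exists_real_char m : (m %% 8 \in [:: 1; 2; 3; 5; 6])%N ->
  exists M chi a b t, [/\ (0 < M)%N, (m %| M)%N & real_char M chi] /\
    [/\ chi b = -1, chi a = 1, (m %| t * a + 1)%N,
      t = 1%N \/ [/\ t = 2%N, (2 %| M)%N & odd m] &
      forall l, prime l -> chi l = 1 -> exists s, (l %| s * s + m)%N].
Proof.
move=> m8.
have m0 : (0 < m)%N by case: m m8.
have odd_prime M chi l : (2 %| M)%N -> real_char M chi -> chi l = 1 -> coprime l M /\ odd l.
  move=> M2 h l1; have lM : coprime l M.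
    by apply: contra_eqT l1 => /(real_char_ncop h) ->.
  split=> //; rewrite -coprimen2; exact: coprime_dvdr lM.
have [m4|m4] := eqVneq (m %% 4)%N 1%N.
  have om : odd m by lia.
  have [J [J1 J2 J3 J4]] := jacobi_exists om.
  have h := real_charMM real_char_chi4 J1.
  exists (4 * m)%N, (fun n => chi4 n * J n), (2 * m).-1, (4 * m).-1, 1%N; split.
    by rewrite muln_gt0 dvdn_mull.
  have E : chi4 m = 1 by rewrite /chi4 m4.
  have JE k : (0 < k)%N -> J (k * m).-1 = 1.
    by move=> k0; rewrite J2 ?E // prednK ?muln_gt0 ?k0 // dvdn_mull.
  rewrite !JE //; split.
  - by rewrite /chi4 (_ : (_ %% 4 = 3)%N) //; lia.
  - by rewrite /chi4 (_ : (_ %% 4 = 1)%N) //; lia.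
  - by rewrite mul1n addn1 prednK ?dvdn_mull ?muln_gt0.
  - by left.
  move=> l pl l1; have [lM ol] := odd_prime _ _ l (dvdn_mulr m (isT : (2 %| 4)%N)) h l1.
  apply: legendre_opp_square => //; rewrite J4 // ?E ?expr1n ?mul1r //.
  by move: lM; rewrite coprimeMr => /andP[].
have [m3|m3] := eqVneq (m %% 8)%N 3%N.
  have om : odd m by lia.
  have [J [J1 J2 J3 J4]] := jacobi_exists om.
  pose one2 n : int := (odd n)%:R.
  have h2 : real_char 2 one2.
    split=> //.
    - by move=> x y; rewrite /one2 oddM; case: (odd x); case: (odd y).
    - by move=> x; rewrite /one2 oddD addbF.
    - by move=> x; rewrite coprimen2 /one2 => ->; left.
    - by move=> x; rewrite coprimen2 /one2 => /negbTE ->.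
  have h := real_charMM h2 J1.
  (* Now [J] is -1 at the class of -1, so [t = 1] is excluded; as [J 2] is also -1, half of [m - 1]
     has symbol 1. *)
  exists (2 * m)%N, (fun n => one2 n * J n), m.-1./2, (2 * m).-1, 2%N; split.
    by rewrite muln_gt0 dvdn_mull.
  have E : chi4 m = -1 by rewrite /chi4 (_ : (m %% 4 = 3)%N) //; lia.
  have am : (2 * m.-1./2 + 1 = m)%N by lia.
  split.
  - rewrite J2 ?prednK ?dvdn_mull ?muln_gt0 // E /one2 (_ : odd _) //; lia.
  - have : J (2 * m.-1./2)%N = -1 by rewrite J2 ?E // -addn1 am.
    rewrite (real_charM J1) J3 /chi8 m3 /one2 /= mulN1r => /oppr_inj ->.
    by rewrite (_ : odd _) //; lia.
  - by rewrite am.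
  - by right; rewrite dvdn_mulr.
  move=> l pl l1; have [lM ol] := odd_prime _ _ l (dvdn_mulr m (isT : (2 %| 2)%N)) h l1.
  apply: legendre_opp_square => //; rewrite J4 // ?E.
    by rewrite sign_half_chi4 // mulrA (_ : chi4 l * chi4 l = one2 l) // -sign_half_chi4 // -expr2 sqrr_sign /one2 ol.
  by move: lM; rewrite coprimeMr => /andP[].
have [u Em] : exists u, m = (2 * u)%N by exists m./2; move: m8; rewrite !inE; lia.
have ou : odd u by move: m8; rewrite Em !inE; lia.
have u0 := odd_gt0 ou.
have [J [J1 J2 J3 J4]] := jacobi_exists ou.
have u4 : chi4 u = 1 \/ chi4 u = -1.
  by rewrite /chi4; case: eqP => ?; [left | case: eqP => ?; [right|lia]].
(* For [m = 2 * u], [w] is the symbol of -2 times the reciprocity sign of [u]. It takes opposite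
   values at 3 and 7 modulo 8, the classes of [(2 * m).-1] and [(4 * m).-1]. *)
have [M' [w [[M'0 M'2 hw] [w3 w7 wl]]]] : exists M' w, [/\ (0 < M')%N, (2 %| M')%N & real_char M' w] /\ [/\
    forall n, (n %% 8 = 3)%N -> w n = chi4 u, forall n, (n %% 8 = 7)%N -> w n = - chi4 u &
    forall l, odd l -> w l = chi4 l * chi8 l * chi4 u ^+ l./2].
  have h48 n k : (n %% 8 = k)%N -> (chi4 n = chi4 k) * (chi8 n = chi8 k).
    by move=> <-; rewrite /chi4 /chi8 modn_mod modn_dvdm.
  have [E|E] := u4; rewrite E; [exists (4 * 8)%N, (fun n => chi4 n * chi8 n) | exists 8%N, chi8].
    split; first by split=> //; exact: real_charMM real_char_chi4 real_char_chi8.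
    by split=> [n /h48[-> ->]|n /h48[-> ->]|l _] //; rewrite expr1n mulr1.
  split; first by split=> //; exact: real_char_chi8.
  split=> [n /h48[_ ->]|n /h48[_ ->]|l ol] //.
  by rewrite sign_half_chi4 // mulrAC -sign_half_chi4 // -expr2 sqrr_sign mul1r.
have h := real_charMM hw J1.
exists (M' * u)%N, (fun n => w n * J n), (2 * m).-1, (4 * m).-1, 1%N; split.
  by rewrite muln_gt0 M'0 u0 Em dvdn_mul.
have JE k : (0 < k)%N -> J (k * m).-1 = chi4 u.
  by move=> k0; rewrite J2 // prednK ?muln_gt0 ?k0 // Em mulnA dvdn_mull.
have uu : chi4 u * chi4 u = 1 by have [->|->] := u4.
rewrite !JE // (w7 (4 * m).-1) ?(w3 (2 * m).-1) ?mulNr ?uu; try lia; split=> //.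
- by rewrite mul1n addn1 prednK ?dvdn_mull ?muln_gt0.
- by left.
move=> l pl l1; have [lM ol] := odd_prime _ _ l (dvdn_mulr u M'2) h l1.
apply: legendre_opp_square => //; rewrite -l1 wl // Em.
rewrite (real_charM (real_char_legendre pl ol)) legendre2 // J4 //; first by ring.
by move: lM; rewrite coprimeMr => /andP[].
Qed.

Lemma three_squares_congruences m : (m %% 8 \in [:: 1; 2; 3; 5; 6])%N ->
  exists t t' s r e, [/\ (0 < t)%N, (t * t' = s * s + m)%N & (r * r * t + 1 = m * e)%N].
Proof.
move=> m8; have [M [chi [a [b [t [[M0 mM h] [cb ca mt t12 hl]]]]]]] := exists_real_char m8.
have [q [q0 qa fq]] := exists_divisor_sum_neq0 M0 h cb ca.
have aM : coprime a M by apply: contra_eqT ca => /(real_char_ncop h) ->.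
have qM : coprime q M by rewrite -coprime_modl qa coprime_modl.
have [k [q1 [s [Eq qs]]]] := divisor_sum_neq0 h hl q0 qM fq.
have q10 : (0 < q1)%N by move: q0; rewrite Eq muln_gt0 => /andP[].
have mq : (m %| t * q + 1)%N.
  have qam : q = a %[mod m] by rewrite -(modn_dvdm q mM) qa modn_dvdm.
  by rewrite /dvdn -modnDml -modnMmr qam modnMmr modnDml.
have [s' ts] : exists s', (t * q1 %| s' * s' + m)%N.
  have [->|[-> M2 om]] := t12; first by exists s; rewrite mul1n.
  have oq1 : odd q1.
    by move: (coprime_dvdr M2 qM); rewrite coprimen2 Eq oddM => /andP[].
  (* Adding the odd [q1] to an even [s] keeps the congruence modulo [q1] and makes [s' * s' + m]
     even. *)
  pose s' := (s + (~~ odd s) * q1)%N; exists s'.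
  have os' : odd s' by rewrite /s' oddD oddM oq1; case: (odd s).
  rewrite Gauss_dvd ?coprime2n // dvdn2 oddD oddM os' om /=.
  rewrite (_ : s' * s' + m = s * s + m + (~~ odd s) * (2 * s + (~~ odd s) * q1) * q1)%N.
    by rewrite dvdn_addr // dvdn_mull.
  by rewrite /s'; ring.
move/dvdnP: ts => [t' Et']; move/dvdnP: mq => [e Ee].
(* The root [k] of the square part of [q] serves as [r], since [k * k * (t * q1) = t * q]. *)
exists (t * q1)%N, t', s', k, e; split.
- by rewrite muln_gt0 q10; case: t12 => [->|[-> _ _]].
- by rewrite Et' mulnC.
- by rewrite [RHS]mulnC -Ee Eq; ring.
Qed.

Open Scope Z_scope.

Lemma three_squares (m : Z) : 0 <= m ->
  m mod 8 = 1 \/ m mod 8 = 2 \/ m mod 8 = 3 \/ m mod 8 = 5 \/ m mod 8 = 6 ->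
  exists x y z, m = x * x + y * y + z * z.
Proof.
move=> m0 m8; have Em : Z.of_nat (Z.to_nat m) = m by rewrite Z2Nat.id.
have /three_squares_congruences[t [t' [s [r [e [t0 E1 E2]]]]]] :
    (Z.to_nat m %% 8 \in [:: 1; 2; 3; 5; 6])%N.
  by rewrite !inE; have : Z.of_nat (Z.to_nat m %% 8)%N = m mod 8; [mod_lia | lia].
apply: (@three_squares_of_congruences m (Z.of_nat t) (Z.of_nat t') (Z.of_nat s)
  (Z.of_nat r) (Z.of_nat e)); lia.
Qed.

Theorem theorem4p1 (a b : Z) (ha : 1 <= a) (hab : a <= b) :
  universal a b <-> (a = 1 /\ (b = 1 \/ b = 2 \/ b = 3 \/ b = 4 \/ b = 5)).
Proof.
split=> [U|[-> hb]]; last exact: (universal_one _ three_squares hb).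
by have [a1 b5] := universal_necessary _ _ ha hab U; split; lia.
Qed.
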